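(* Let $y^*\in\{0,1\}^F$ be given. Let $\mathcal U=\{s\in\{0,1\}^F:\sum_{j\in F}s_j\le\Gamma\}$ and, for $y\in\{0,1\}^F$, $\mathcal U(y)=\{s\in\{0,1\}^F:\sum_{j\in F}s_j\le\Gamma,\ s_j\le y_j\ \forall j\in F\}$. Then: (a) $\mathcal U(y)$ is a subset of $\mathcal U$ for every $y\in\{0,1\}^F$. (b) The problems $$\text{(SP-1)}\quad \max_{s\in\mathcal U}\ \min_{(x,u)\in\phi_1(y^*,s)}\ \sum_{j}f_jy_j^*+\sum_{i}\sum_{j}c_{ij}x_{ij}+\sum_{i}\rho_iu_i$$ and $$\text{(SP-2)}\quad \max_{s\in\mathcal U(y^* )}\ \min_{(x,u)\in\phi_2(y^*,s)}\ \sum_{j}f_jy_j^*+\sum_{i}\sum_{j}c_{ij}x_{ij}+\sum_{i}\rho_iu_i$$ have the same optimal value.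
   Context: Data: finite nonempty sets $N$ (customers) and $F$ (facilities); real numbers, all nonnegative: fixed cost $f_j$ and capacity $K_j$ for $j\in F$; demand $d_i$ and unit unmet-demand penalty $\rho_i$ for $i\in N$; unit allocation cost $c_{ij}$ for $i\in N,j\in F$; and a nonnegative integer $\Gamma$. Sums over $i$ are over $N$ and sums over $j$ are over $F$. $\phi_1(y^*,s)$ is the set of minimizers of $\sum_iu_i$ over all $(x,u)\in\mathbb R^{N\times F}\times\mathbb R^N$ with $x\ge0$, $u\ge0$, $\sum_{i}x_{ij}\le K_jy_j^*(1-s_j)$ for all $j\in F$, and $\sum_{j}x_{ij}+u_i=d_i$ for all $i\in N$. $\phi_2(y^*,s)$ is the set of minimizers of $\sum_iu_i$ over all $(x,u)\in\mathbb R^{N\times F}\times\mathbb R^N$ with $x\ge0$, $u\ge0$, $\sum_{i}x_{ij}\le K_jy_j^*(1-s_j)$ for all $j\in F$, $\sum_{i}x_{ij}\le K_jy_j^*$ for all $j\in F$, and $\sum_{j}x_{ij}+u_i=d_i$ for all $i\in N$. *)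

(* Defs.v *)
From mathcomp Require Import all_boot all_order all_algebra.
From mathcomp Require Import classical_sets reals.
Set Implicit Arguments.
Unset Strict Implicit.
Unset Printing Implicit Defensive.
Import Order.TTheory GRing.Theory Num.Theory.
Local Open Scope classical_set_scope.
Local Open Scope ring_scope.

Definition minimizers (R : realType) (Z : Type) (f : Z -> R) (A : set Z) :
  set Z := [set z | A z /\ forall z', A z' -> f z <= f z'].

Definition is_minimum (R : realType) (A : set R) (v : R) : Prop :=
  A v /\ lbound A v.

Definition is_maximum (R : realType) (A : set R) (v : R) : Prop :=
  A v /\ ubound A v.

(* v is the value of  max_(s in U) min_(z in phi s) f z,  where max and min are
   attained: the inner minimum g s must exist for every s in U. *)
Definition is_max_min_value (R : realType) (S Z : Type) (U : set S)
    (phi : S -> set Z) (f : Z -> R) (v : R) : Prop :=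
  exists g : S -> R,
    (forall s, U s -> is_minimum (f @` phi s) (g s)) /\
    is_maximum (g @` U) v.

(* Elements of {0,1}^F are boolean functions on F; b : bool is read as the
   number 0 or 1 through the coercion to nat, and (b%:R) in R. *)
Definition uncertainty_set (F : finType) (Gamma : nat) :
  set {ffun F -> bool} :=
  [set s : {ffun F -> bool} | (\sum_j s j <= Gamma)%N].

Definition uncertainty_set_at (F : finType) (Gamma : nat)
    (y : {ffun F -> bool}) : set {ffun F -> bool} :=
  [set s : {ffun F -> bool} | (\sum_j s j <= Gamma)%N /\ forall j, (s j <= y j)%N].

Section Recourse.
Variables (R : realType) (N F : finType).

Definition recourse : Type := ((N -> F -> R) * (N -> R))%type.

Definition unmet (z : recourse) : R := \sum_i z.2 i.

Definition feasible1 (K : F -> R) (d : N -> R) (y s : {ffun F -> bool}) :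
  set recourse :=
  [set z | [/\ forall i j, 0 <= z.1 i j,
               forall i, 0 <= z.2 i,
               forall j, \sum_i z.1 i j <= K j * (y j)%:R * (1 - (s j)%:R)
             & forall i, \sum_j z.1 i j + z.2 i = d i]].

Definition feasible2 (K : F -> R) (d : N -> R) (y s : {ffun F -> bool}) :
  set recourse :=
  [set z | [/\ forall i j, 0 <= z.1 i j,
               forall i, 0 <= z.2 i,
               forall j, \sum_i z.1 i j <= K j * (y j)%:R * (1 - (s j)%:R),
               forall j, \sum_i z.1 i j <= K j * (y j)%:R
             & forall i, \sum_j z.1 i j + z.2 i = d i]].

Definition phi1 (K : F -> R) (d : N -> R) (y s : {ffun F -> bool}) :
  set recourse := minimizers unmet (feasible1 K d y s).

Definition phi2 (K : F -> R) (d : N -> R) (y s : {ffun F -> bool}) :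
  set recourse := minimizers unmet (feasible2 K d y s).

Definition total_cost (f : F -> R) (c : N -> F -> R) (rho : N -> R)
    (y : {ffun F -> bool}) (z : recourse) : R :=
  \sum_j f j * (y j)%:R + \sum_i \sum_j c i j * z.1 i j
  + \sum_i rho i * z.2 i.

End Recourse.

(* Main.v *)
Require Import Defs.
From mathcomp Require Import all_boot all_order all_algebra.
From mathcomp Require Import boolp classical_sets reals.
From mathcomp Require Import topology normedtype derive.
Set Implicit Arguments.
Unset Strict Implicit.
Unset Printing Implicit Defensive.
Import Order.TTheory GRing.Theory Num.Theory.
Import numFieldNormedType.Exports.
Local Open Scope classical_set_scope.
Local Open Scope ring_scope.

(** The feasible set only depends on the usable capacities K_j y_j (1 - s_j), so
    failing a facility that is not open changes nothing: s and its pointwise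
    meet with y have the same recourse problem, and the meet lies in U(y).  The
    extra capacity constraint in phi_2 is implied by the first one since
    1 - s_j <= 1.  All optima are attained because the feasible set is a
    nonempty compact polytope and U is finite. *)

(** * Attainment and uniqueness of optima *)

Lemma is_minimum_unique (R : realType) (A : set R) v w :
  is_minimum A v -> is_minimum A w -> v = w.
Proof.
by move=> [Av lv] [Aw lw]; apply: le_anti; rewrite lv ?lw.
Qed.

Lemma finite_is_maximum (R : realType) (S : finType) (U : set S) (g : S -> R) :
  U !=set0 -> exists v, is_maximum (g @` U) v.
Proof.
move=> [s0 Us0]; have /asboolP Ps0 := Us0.
(* Reflecting membership in [U] into a boolean predicate turns the supremum into an argmax over the
   finite type [S]. *)
case: (@Order.TotalTheory.arg_maxP _ R S s0 (fun s => `[< U s >]) g Ps0).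
move=> s /asboolP Us smax; exists (g s); split; first by exists s.
by move=> _ [t Ut <-]; apply: smax; apply/asboolP.
Qed.

(** Compactness is recorded along with nonemptiness so that a second objective can then be minimized
    over the set of minimizers. *)
Lemma compact_minimizers (R : realType) (T : topologicalType) (f : T -> R)
    (A : set T) :
  A !=set0 -> compact A -> continuous f ->
  minimizers f A !=set0 /\ compact (minimizers f A).
Proof.
move=> A0 cA cf.
have [z0 + z0min] := compact_EVT_min A0 cA (continuous_subspaceT cf).
rewrite inE => Az0.
have z0le z : A z -> f z0 <= f z by move=> Az; apply: z0min; rewrite inE.
split; first by exists z0.
(* The minimizers are the points of [A] in the sublevel set of [f] at its minimum value, which is
   closed by continuity. *)
rewrite (_ : minimizers f A = A `&` f @^-1` [set x | x <= f z0]); last first.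
  apply/seteqP; split=> z [Az zle]; split=> //; first exact: zle.
  by move=> z' Az'; apply: le_trans (z0le _ Az').
apply: compact_closedI => //.
by move/continuous_closedP: cf; apply; exact: closed_le.
Qed.

(** Two-level minimization: the extreme value theorem is applied to [f] on [A], then to [h] on the
    compact set of minimizers. *)
Lemma minimizers_is_minimum (R : realType) (T : topologicalType) (f h : T -> R)
    (A : set T) :
  A !=set0 -> compact A -> continuous f -> continuous h ->
  exists v, is_minimum (h @` minimizers f A) v.
Proof.
move=> A0 cA cf ch; have [M0 cM] := compact_minimizers A0 cA cf.
have [z + zmin] := compact_EVT_min M0 cM (continuous_subspaceT ch).
rewrite inE => Mz; exists (h z); split; first by exists z.
by move=> _ [t Mt <-]; apply: zmin; rewrite inE.
Qed.

Lemma continuous_sum (R : realType) (T : topologicalType) (I : finType)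
    (F : I -> T -> R) :
  (forall i, continuous (F i)) -> continuous (fun z => \sum_i F i z).
Proof.
by move=> cF; apply: continuous_big => [|i _]; [exact: add_continuous|exact: cF].
Qed.

Lemma continuous_add (R : realType) (T : topologicalType) (f g : T -> R) :
  continuous f -> continuous g -> continuous (fun z => f z + g z).
Proof. by move=> cf cg z; exact: continuousD (cf z) (cg z). Qed.

Lemma continuous_scale (R : realType) (T : topologicalType) (a : R)
    (f : T -> R) :
  continuous f -> continuous (fun z => a * f z).
Proof. by move=> cf z; exact: continuousM (@cst_continuous _ _ a z) (cf z). Qed.

(** * The recourse polytope and its inner minimum *)

Section Attainment.
Variables (R : realType) (N F : finType).

(* Convertible to [recourse R N F], but carrying the product topology. *)
Local Notation recourse_top := ({ptws N -> {ptws F -> R}} * {ptws N -> R})%type.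

Lemma continuous_alloc (i : N) (j : F) :
  continuous (fun z : recourse_top => z.1 i j).
Proof.
move=> z; apply: (@continuous_comp _ _ _ (fun z : recourse_top => z.1 i)
  (fun g : {ptws F -> R} => g j)).
  apply: (@continuous_comp _ _ _ (@fst _ _)
    (fun g : {ptws N -> {ptws F -> R}} => g i)); first exact: cvg_fst.
  exact: (@proj_continuous N (fun=> {ptws F -> R})).
exact: (@proj_continuous F (fun=> R)).
Qed.

Lemma continuous_unmet_at (i : N) : continuous (fun z : recourse_top => z.2 i).
Proof.
move=> z; apply: (@continuous_comp _ _ _ (@snd _ _)
  (fun g : {ptws N -> R} => g i)); first exact: cvg_snd.
exact: (@proj_continuous N (fun=> R)).
Qed.

Lemma continuous_unmet : continuous (@unmet R N F : recourse_top -> R).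
Proof. by apply: continuous_sum => i; exact: continuous_unmet_at. Qed.

Lemma continuous_total_cost (f : F -> R) (c : N -> F -> R) (rho : N -> R) y :
  continuous (total_cost f c rho y : recourse_top -> R).
Proof.
rewrite /total_cost; apply: continuous_add; first apply: continuous_add.
- exact: cst_continuous.
- apply: continuous_sum => i; apply: continuous_sum => j.
  by apply: continuous_scale; exact: continuous_alloc.
- apply: continuous_sum => i.
  by apply: continuous_scale; exact: continuous_unmet_at.
Qed.

Variables (K : F -> R) (d : N -> R).
Hypotheses (K_ge0 : forall j, 0 <= K j) (d_ge0 : forall i, 0 <= d i).

(** Each constraint is the preimage of a closed subset of the reals under a continuous function, and
    intersections of closed sets are closed. *)
Lemma closed_feasible1 y s :
  closed (feasible1 K d y s : set recourse_top).
Proof.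
pose A1 := \bigcap_(i in [set: N]) \bigcap_(j in [set: F])
  ((fun z : recourse_top => z.1 i j) @^-1` [set x | 0 <= x]).
pose A2 := \bigcap_(i in [set: N])
  ((fun z : recourse_top => z.2 i) @^-1` [set x | 0 <= x]).
pose A3 := \bigcap_(j in [set: F])
  ((fun z : recourse_top => \sum_i z.1 i j) @^-1`
     [set x | x <= K j * (y j)%:R * (1 - (s j)%:R)]).
pose A4 := \bigcap_(i in [set: N])
  ((fun z : recourse_top => \sum_j z.1 i j + z.2 i) @^-1` [set x | x = d i]).
rewrite (_ : feasible1 K d y s = A1 `&` A2 `&` A3 `&` A4); last first.
  apply/seteqP; split=> z.
    case=> x_ge0 u_ge0 cap dem.
    by split; [split; [split|]|] => [i _ j _|i _|j _|i _];
      [exact: x_ge0|exact: u_ge0|exact: cap|exact: dem].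
  case=> -[[x_ge0 u_ge0] cap] dem.
  by split=> [i j|i|j|i];
    [exact: x_ge0|exact: u_ge0|exact: cap|exact: dem].
do 3?apply: closedI; rewrite /A1 /A2 /A3 /A4.
- apply: closed_bigI => i _; apply: closed_bigI => j _.
  by apply: (continuous_closedP _).1; [exact: continuous_alloc|exact: closed_ge].
- apply: closed_bigI => i _.
  by apply: (continuous_closedP _).1; [exact: continuous_unmet_at|exact: closed_ge].
- apply: closed_bigI => j _; apply: (continuous_closedP _).1; last exact: closed_le.
  by apply: continuous_sum => i; exact: continuous_alloc.
- apply: closed_bigI => i _; apply: (continuous_closedP _).1; last exact: closed_eq.
  apply: continuous_add; last exact: continuous_unmet_at.
  by apply: continuous_sum => j; exact: continuous_alloc.
Qed.

(** By the demand equation, each x_ij and each u_i is one of the nonnegative terms summing to d_i,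
    hence lies in [0, d_i]. The resulting box is compact by Tychonoff, applied twice for the doubly
    indexed x. *)
Lemma compact_feasible1 y s : compact (feasible1 K d y s : set recourse_top).
Proof.
pose box1 : set {ptws N -> {ptws F -> R}} :=
  [set x | forall i, [set g : {ptws F -> R} | forall j, [set` `[0, d i]] (g j)] (x i)].
pose box2 : set {ptws N -> R} := [set u | forall i, [set` `[0, d i]] (u i)].
apply: (@subclosed_compact _ _ (box1 `*` box2)).
- exact: closed_feasible1.
- apply: compact_setX.
    apply: (@tychonoff N (fun=> {ptws F -> R}) (fun i =>
      [set g : {ptws F -> R} | forall j, [set` `[0, d i]] (g j)])) => i.
    apply: (@tychonoff F (fun=> R) (fun=> [set` `[0, d i]])) => j.
    exact: segment_compact.
  apply: (@tychonoff N (fun=> R) (fun i => [set` `[0, d i]])) => i.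
  exact: segment_compact.
move=> z [x_ge0 u_ge0 _ dE]; split=> [i j|i] /=; rewrite in_itv /=.
  rewrite x_ge0 /= -(dE i) (bigD1 j) //= -addrA lerDl addr_ge0 ?sumr_ge0 //.
by rewrite u_ge0 /= -(dE i) lerDr sumr_ge0.
Qed.

Lemma feasible1_nonempty y s : feasible1 K d y s !=set0.
Proof.
(* Ship nothing and leave all demand unmet. *)
exists (fun _ _ => 0, d); split=> //= [j|i]; last by rewrite big1 ?add0r.
by rewrite big1 // !mulr_ge0 // subr_ge0 lern1 leq_b1.
Qed.

Lemma feasible2E y s : feasible2 K d y s = feasible1 K d y s.
Proof.
apply/seteqP; split=> z; first by case.
case=> x_ge0 u_ge0 cap dem; split=> // j; apply: le_trans (cap j) _.
by rewrite ler_piMr ?mulr_ge0 // gerBl.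
Qed.

Lemma phi2E y s : phi2 K d y s = phi1 K d y s.
Proof. by rewrite /phi2 feasible2E. Qed.

Lemma phi1_is_minimum (f : F -> R) (c : N -> F -> R) (rho : N -> R) y s :
  exists v, is_minimum (total_cost f c rho y @` phi1 K d y s) v.
Proof.
apply: (@minimizers_is_minimum R recourse_top).
- exact: feasible1_nonempty.
- exact: compact_feasible1.
- exact: continuous_unmet.
- exact: continuous_total_cost.
Qed.

End Attainment.

(** * Restricting failures to open facilities *)

Definition open_part (F : finType) (y s : {ffun F -> bool}) : {ffun F -> bool} :=
  [ffun j => s j && y j].

Lemma phi1_open_part (R : realType) (N F : finType) (K : F -> R) (d : N -> R)
    (y s : {ffun F -> bool}) :
  phi1 K d y (open_part y s) = phi1 K d y s.
Proof.
rewrite /phi1; congr (minimizers _ _).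
have capE j : K j * (y j)%:R * (1 - (open_part y s j)%:R)
            = K j * (y j)%:R * (1 - (s j)%:R).
  (* If y_j = 1 the meet is s_j itself; if y_j = 0 both capacities vanish. *)
  by rewrite ffunE; case: (y j); rewrite ?andbT // mulr0 !mul0r.
by apply/seteqP; split=> z [? ? cap ?]; split=> // j; move: (cap j); rewrite capE.
Qed.

Lemma open_part_uncertainty (F : finType) (Gamma : nat)
    (y s : {ffun F -> bool}) :
  uncertainty_set Gamma s -> uncertainty_set_at Gamma y (open_part y s).
Proof.
move=> sG; split=> [|j]; last by rewrite ffunE; case: (s j); case: (y j).
apply: leq_trans sG; apply: leq_sum => j _.
by rewrite ffunE; case: (s j); case: (y j).
Qed.

Theorem proposition7 (R : realType) (N F : finType)
    (N_gt0 : (0 < #|N|)%N) (F_gt0 : (0 < #|F|)%N)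
    (f K : F -> R) (d rho : N -> R) (c : N -> F -> R) (Gamma : nat)
    (f_ge0 : forall j, 0 <= f j) (K_ge0 : forall j, 0 <= K j)
    (d_ge0 : forall i, 0 <= d i) (rho_ge0 : forall i, 0 <= rho i)
    (c_ge0 : forall i j, 0 <= c i j) (ystar : {ffun F -> bool}) :
  (forall y : {ffun F -> bool},
     uncertainty_set_at Gamma y `<=` @uncertainty_set F Gamma) /\
  (exists v : R,
     is_max_min_value (uncertainty_set Gamma) (phi1 K d ystar)
       (total_cost f c rho ystar) v /\
     is_max_min_value (uncertainty_set_at Gamma ystar) (phi2 K d ystar)
       (total_cost f c rho ystar) v).
Proof.
have subU y : uncertainty_set_at Gamma y `<=` @uncertainty_set F Gamma.
  by move=> s [].
split=> //.
(* The inner minimum exists for every s, so one function [g] can serve both problems. *)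
have [g gmin] := choice (phi1_is_minimum K_ge0 d_ge0 f c rho ystar).
have gE s : g (open_part ystar s) = g s.
  have := gmin (open_part ystar s); rewrite phi1_open_part.
  by move/is_minimum_unique; apply.
(* Both outer problems maximize over the same set of values: each s in U can be replaced by its meet
   with [ystar] without changing [g]. *)
have imgE : g @` uncertainty_set Gamma = g @` uncertainty_set_at Gamma ystar.
  apply/seteqP; split=> _ [s Us <-]; last by exists s => //; exact: subU Us.
  by exists (open_part ystar s) => //; exact: open_part_uncertainty.
have U0 : @uncertainty_set F Gamma !=set0.
  (* The scenario without failures fits any budget, even [Gamma] = 0. *)
  by exists [ffun=> false]; rewrite /uncertainty_set /= big1 // => j _; rewrite ffunE.
have [v vmax] := finite_is_maximum g U0.
exists v; split; exists g; split=> //; last by rewrite -imgE.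
by move=> s _; rewrite phi2E.
Qed.
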